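(* Let $p$ be a prime, let $b\ge2$ be an integer, let $p=\sum_{i=0}^n a_ib^i$ be the base-$b$ expansion of $p$ with integer digits $0\le a_i\le b-1$, and let $f(x)=a_nx^n+\cdots+a_1x+a_0\in\mathbb{Z}[x]$. If $f(x)$ is a non-constant irreducible polynomial, then $f(x)$ is proper.
   Context: A non-constant polynomial in $\mathbb{Z}[x]$ is called proper if its values at integers are relatively prime, i.e. the greatest common divisor of all the values $f(n)$, $n\in\mathbb{Z}$, is $1$. (By the generalized Cohn irreducibility criterion, a known result, such an $f$ is always irreducible in $\mathbb{Z}[x]$.) *)

(* Defs.v *)
From mathcomp Require Import all_boot all_order all_algebra.

Set Implicit Arguments.
Unset Strict Implicit.
Unset Printing Implicit Defensive.

Import Order.TTheory GRing.Theory Num.Theory.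
Local Open Scope ring_scope.

(* Irreducibility in the sense of ring theory. MathComp's [irreducible_poly]
   relies on pseudo-division, so on {poly int} it ignores constant factors
   and amounts to irreducibility over the rationals. *)
Definition irreducible_elt (R : idomainType) (x : R) : Prop :=
  [/\ x != 0, x \isn't a GRing.unit &
      forall y z : R, x = y * z -> y \is a GRing.unit \/ z \is a GRing.unit].

(* [gcdz] is binary; here the family is possibly infinite. *)
Definition is_gcd_family (I : Type) (v : I -> int) (d : int) : Prop :=
  [/\ 0 <= d, forall i : I, (d %| v i)%Z &
      forall e : int, (forall i : I, (e %| v i)%Z) -> (e %| d)%Z].

Definition proper_poly (f : {poly int}) : Prop :=
  (1 < size f)%N /\ is_gcd_family (fun n : int => f.[n]) 1.

(* Main.v *)
Require Import Defs.
From mathcomp Require Import all_boot all_order all_algebra.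

Import Order.TTheory GRing.Theory Num.Theory.
Local Open Scope ring_scope.

(* If the common divisor of the values is not 1, it is p itself, because
   f(b) = p.  Then the reduction of f modulo p vanishes on all of 'F_p.  With
   d = deg f >= 1, nonnegativity of the digits gives b ^ d <= p, so the leading
   digit is nonzero modulo p and d < 2 ^ d <= p: the reduction is a nonzero
   polynomial with p roots and degree less than p, which is impossible. *)

Lemma expr_degree_le_horner (R : numDomainType) (f : {poly R}) (b : R) :
  (forall i, 0 <= f`_i) -> 0 <= b -> 1 <= lead_coef f ->
  b ^+ (size f).-1 <= f.[b].
Proof.
move=> f_ge0 b_ge0 lc_ge1.
have : (0 < size f)%N.
  by rewrite size_poly_gt0 -lead_coef_eq0 gt_eqF // (lt_le_trans ltr01).
rewrite horner_coef /lead_coef in lc_ge1 *; case: (size f) lc_ge1 => // d lc_ge1 _.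
(* The top term alone reaches the bound, its coefficient being at least 1; the other terms are
   nonnegative. *)
rewrite big_ord_recr /=; apply: le_trans (_ : f`_d * b ^+ d <= _).
  by rewrite ler_peMl ?exprn_ge0.
by rewrite lerDr sumr_ge0 // => i _; rewrite mulr_ge0 ?exprn_ge0.
Qed.

(** The leading coefficient survives reduction modulo p, so the reduction is nonzero, yet all p
    elements of ['F_p] are roots of it. *)
Lemma dvdz_values_degree (p : nat) (f : {poly int}) :
  prime p -> ~~ (p%:Z %| lead_coef f)%Z ->
  (forall m : int, (p%:Z %| f.[m])%Z) -> (p < size f)%N.
Proof.
move=> p_prime lcNp values.
have intrF (m : int) : ((m%:~R == 0 :> 'F_p) = (p%:Z %| m)%Z).
  rewrite dvdzE; case: m => m.
    by rewrite -pmulrn -(dvdn_pcharf (pchar_Fp p_prime)).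
  by rewrite NegzE mulrNz oppr_eq0 -pmulrn -(dvdn_pcharf (pchar_Fp p_prime)).
pose g : {poly 'F_p} := map_poly intr f.
have g_neq0 : g != 0.
  apply/eqP => /(congr1 (fun q : {poly 'F_p} => q`_(size f).-1)).
  by rewrite coef_map coef0 => /eqP; rewrite intrF (negbTE lcNp).
have rootg : all (root g) (enum 'F_p).
  apply/allP => x _.
  (* Each residue class has an integer representative, so a root modulo p is a value of [f]
     divisible by p. *)
  rewrite -[x]natr_Zp pmulrn /root horner_map /= intrF.
  exact: values.
have := max_poly_roots g_neq0 rootg (enum_uniq _).
rewrite -cardE card_Fp // => /leq_trans; apply; exact: size_poly.
Qed.

Theorem proposition1 (p : nat) (b : int) (n : nat) (a : nat -> int)
    (f : {poly int})
    (p_prime : prime p)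
    (b_ge2 : 2 <= b)
    (a_digit : forall i : nat, (i <= n)%N -> 0 <= a i <= b - 1)
    (p_expansion : p%:Z = \sum_(i < n.+1) a i * b ^+ i)
    (f_def : f = \poly_(i < n.+1) a i)
    (f_nonconstant : (1 < size f)%N)
    (f_irreducible : irreducible_elt f) :
  proper_poly f.
Proof.
have b_ge1 : 1 <= b by apply: le_trans b_ge2.
have fb : f.[b] = p by rewrite f_def horner_poly p_expansion.
have f_digit i : 0 <= f`_i <= b - 1.
  (* Beyond index [n] the coefficient is 0, which is a legal digit because [1 <= b]. *)
  rewrite f_def coef_poly ltnS; case: ifP => [/a_digit //|_].
  by rewrite lexx subr_ge0.
have f_ge0 i : 0 <= f`_i by case/andP: (f_digit i).
have lc_gt0 : 0 < lead_coef f.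
  by rewrite lt_def f_ge0 lead_coef_eq0 -size_poly_gt0 (ltnW f_nonconstant).
have expb_le_p : b ^+ (size f).-1 <= p.
  by rewrite -fb expr_degree_le_horner // (le_trans ler01).
have size_le_p : (size f <= p)%N.
  (* With d the degree, [size f] is d + 1 <= 2 ^ d <= b ^ d <= p. *)
  have : (2 ^ (size f).-1 <= p)%N.
    rewrite -lez_nat -natz natrX; apply: le_trans expb_le_p.
    by rewrite lerXn2r ?nnegrE // (le_trans ler01).
  by apply: leq_trans; rewrite -{1}(ltn_predK f_nonconstant) ltn_expl.
have lc_lt_p : lead_coef f < p.
  (* The leading digit is at most b - 1 < b <= b ^ d <= p; the middle bound needs d >= 1. *)
  have /andP[_ lc_le] := f_digit (size f).-1.
  apply: lt_le_trans expb_le_p; apply: le_lt_trans lc_le _.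
  apply: lt_le_trans (_ : b <= _); first by rewrite ltrBlDr ltrDl.
  by rewrite ler_eXnr // -ltnS (ltn_predK f_nonconstant).
have lcNp : ~~ (p%:Z %| lead_coef f)%Z.
  apply/negP => /dvdz_mod0P; rewrite modz_small => [lc0|].
    by rewrite lc0 in lc_gt0.
  by rewrite (ltW lc_gt0) lc_lt_p.
split=> //; split=> // e e_dvd.
have /primeP[_ p_div] := p_prime.
(* The value at [b] forces the absolute value of [e] to be 1 or p, whatever the sign of [e]. *)
have := e_dvd b; rewrite fb !dvdzE dvdn1 => /p_div /orP[//|/eqP e_p].
have : (p < size f)%N.
  by apply: dvdz_values_degree => // m; have := e_dvd m; rewrite !dvdzE e_p.
by rewrite ltnNge size_le_p.
Qed.
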